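(* Let $(M,h)$ be a Riemannian spin surface with local isothermal coordinates $x,y$, let $\psi=(\psi^1,\dots,\psi^q)$ with $\psi^1,\dots,\psi^q\in\Gamma(\Sigma M)$, and let $i,m\in\{1,\dots,q\}$. If, with summation over $j=1,\dots,q$, $$|P_-\psi^j|_{\Sigma M}^2\langle P_-\psi^i,P_-\psi^m\rangle_{\Sigma M}=|P_+\psi^j|_{\Sigma M}^2\langle P_+\psi^i,P_+\psi^m\rangle_{\Sigma M},$$ then, again with summation over $j$, $$\langle\psi^i,\partial_x\cdot\psi^j\rangle_{\Sigma M}\langle\psi^j,\partial_y\cdot\psi^m\rangle_{\Sigma M} -\langle\psi^i,\partial_y\cdot\psi^j\rangle_{\Sigma M}\langle\psi^j,\partial_x\cdot\psi^m\rangle_{\Sigma M} =2\langle\psi^i,\partial_x\cdot\partial_y\cdot\psi^m\rangle_{\Sigma M}|\psi|^2.$$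
   Context: $\Sigma M$ is the (complex rank 2) spinor bundle of $(M,h)$ with hermitian scalar product $\langle\cdot,\cdot\rangle_{\Sigma M}$. Clifford multiplication by tangent vectors is skew-symmetric, $\langle\psi,X\cdot\eta\rangle=-\langle X\cdot\psi,\eta\rangle$, and satisfies $X\cdot Y\cdot\psi+Y\cdot X\cdot\psi=-2h(X,Y)\psi$. For an oriented local orthonormal frame $e_1,e_2$ the complex volume element is $\omega_{\mathbb{C}}=i\,e_1\cdot e_2$, and $P_\pm=\frac12(1\pm\omega_{\mathbb{C}})$ are the projectors onto the bundles of positive and negative spinors. $|\psi|^2=\sum_{j=1}^q|\psi^j|^2_{\Sigma M}$. *)

(* Defs.v *)
From HB Require Import structures.
From mathcomp Require Import all_boot all_order all_algebra.
From mathcomp Require Import all_classical all_reals all_analysis.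
From mathcomp Require Import complex.

Set Implicit Arguments.
Unset Strict Implicit.
Unset Printing Implicit Defensive.

Import Order.TTheory GRing.Theory Num.Theory.
Import numFieldNormedType.Exports.
Local Open Scope classical_set_scope.
Local Open Scope ring_scope.

Section Smoothness.
Variables (R : realType) (W : normedModType R).

Fixpoint is_Cn (n : nat) (U : set 'rV[R]_2) (f : 'rV[R]_2 -> W) : Prop :=
  if n is k.+1 then
    (forall x, U x -> differentiable f x) /\
    (forall v : 'rV[R]_2, is_Cn k U (fun x => 'D_v f x))
  else forall x, U x -> {for x, continuous f}.

Definition is_smooth (U : set 'rV[R]_2) (f : 'rV[R]_2 -> W) : Prop :=
  forall n, is_Cn n U f.

End Smoothness.

(* A chart is a homeomorphism from an open set onto an open subset of R^2,
   represented by total functions whose values off the domain (resp. off the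
   image) are irrelevant. *)
Record chart (R : realType) (M : Type) := Chart {
  cdom : set M;
  cmap : M -> 'rV[R]_2;
  cinv : 'rV[R]_2 -> M }.

Section Charts.
Variables (R : realType) (M : topologicalType).
Implicit Types c d : chart R M.

Definition is_chart c : Prop :=
  [/\ open (cdom c),
      open (cmap c @` cdom c),
      (forall p, cdom c p -> cinv c (cmap c p) = p),
      (forall p, cdom c p -> {for p, continuous (cmap c)}) &
      (forall x, (cmap c @` cdom c) x -> {for x, continuous (cinv c)})].

Definition transition c d : 'rV[R]_2 -> 'rV[R]_2 := cmap d \o cinv c.

Definition chart_compatible c d : Prop :=
  is_smooth (cmap c @` (cdom c `&` cdom d)) (transition c d) /\
  is_smooth (cmap d @` (cdom c `&` cdom d)) (transition d c).

(* The change of coordinates of tangent vectors at p. *)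
Definition dtransition c d (p : M) : 'rV[R]_2 -> 'rV[R]_2 :=
  'd (transition c d) (cmap c p).

End Charts.

Record surface (R : realType) := Surface {
  points :> topologicalType;
  atlas : set (chart R points);
  surface_hausdorff : hausdorff_space points;
  surface_second_countable : @second_countable points;
  atlas_chart : forall c, atlas c -> is_chart c;
  atlas_cover : forall p, exists2 c, atlas c & cdom c p;
  atlas_compatible : forall c d, atlas c -> atlas d -> chart_compatible c d;
  atlas_maximal : forall c, is_chart c ->
    (forall d, atlas d -> chart_compatible c d) -> atlas c }.

Section Tangent.
Variables (R : realType) (M : surface R).

(* A tangent vector at p is given by its coordinate vectors in all the charts
   around p, related by the differentials of the transition maps; the values
   at the other charts are set to 0. *)
Definition tvec : Type := chart R M -> 'rV[R]_2.

Definition tangent (p : M) : set tvec := [set X : tvec |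
  (forall c d, atlas c -> atlas d -> cdom c p -> cdom d p ->
     X d = dtransition c d p (X c)) /\
  (forall c, ~ (atlas c /\ cdom c p) -> X c = 0)].

Definition coord_field (c : chart R M) (k : 'I_2) (p : M) : tvec :=
  fun d => if `[< atlas d /\ cdom d p >]
           then dtransition c d p (delta_mx 0 k) else 0.

Definition smooth_fun (U : set M) (f : M -> R) : Prop :=
  forall c, atlas c -> is_smooth (cmap c @` (cdom c `&` U)) (f \o cinv c).

Definition smooth_Cfun (U : set M) (f : M -> R[i]) : Prop :=
  smooth_fun U (fun p => complex.Re (f p)) /\
  smooth_fun U (fun p => complex.Im (f p)).

Definition smooth_vfield (U : set M) (X : M -> tvec) : Prop :=
  (forall p, U p -> tangent p (X p)) /\
  (forall c, atlas c ->
     is_smooth (cmap c @` (cdom c `&` U)) ((fun p => X p c) \o cinv c)).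

End Tangent.

Record riemannian_metric (R : realType) (M : surface R) := RiemannianMetric {
  riem :> forall p : M, tvec M -> tvec M -> R;
  riem_linear : forall (p : M) (a : R) X Y Z,
    tangent p X -> tangent p Y -> tangent p Z ->
    riem p (a *: X + Y) Z = a * riem p X Z + riem p Y Z;
  riem_sym : forall (p : M) X Y,
    tangent p X -> tangent p Y -> riem p X Y = riem p Y X;
  riem_pos : forall (p : M) X,
    tangent p X -> X <> 0 -> 0 < riem p X X;
  riem_smooth : forall c (k l : 'I_2), atlas c ->
    smooth_fun (cdom c)
      (fun p => riem p (coord_field c k p) (coord_field c l p)) }.

(* An orientation is given by an oriented atlas.  The charts used as local
   coordinates are not required to belong to it. *)
Record orientation (R : realType) (M : surface R) := Orientation {
  positive_charts : set (chart R M);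
  positive_sub : positive_charts `<=` @atlas R M;
  positive_cover : forall p, exists2 c, positive_charts c & cdom c p;
  positive_det : forall c d (p : M), positive_charts c -> positive_charts d ->
    cdom c p -> cdom d p ->
    0 < \det (jacobian (transition c d) (cmap c p)) }.

Definition oriented_orthonormal (R : realType) (M : surface R)
    (h : riemannian_metric M) (o : orientation M) (p : M)
    (e : 'I_2 -> tvec M) : Prop :=
  [/\ (forall k, tangent p (e k)),
      (forall k l, h p (e k) (e l) = (k == l)%:R) &
      (forall c, positive_charts o c -> cdom c p -> 0 < \det (\matrix_(k < 2) e k c))].

Section CliffordRep.
Variable R : realType.
Local Notation C := R[i].

(* The irreducible complex representation of the Clifford algebra of R^2:
   gamma 0 ^ 2 = gamma 1 ^ 2 = -1, the two matrices anticommute and are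
   skew-hermitian, and i * gamma 0 * gamma 1 = diag(1, -1). *)
Definition gamma (k : 'I_2) : 'M[C]_2 :=
  if k == 0 then \matrix_(a, b) (if a == b then 0 else if a == 0 then -1 else 1)
  else \matrix_(a, b) (if a == b then 0 else 'i).

(* Spin(2) = {s + t e_0 e_1 | s^2 + t^2 = 1} is identified with the unit
   circle by z = s + i t.  The double covering Spin(2) -> SO(2) is then
   z |-> rotation of angle arg (z ^ 2), since
   (s + t e_0 e_1) e_0 (s + t e_0 e_1)^-1 = (s + t e_0 e_1)^2 e_0. *)
Definition spin_cover (z : C) : 'M[R]_2 :=
  \matrix_(a, b) (if a == b then complex.Re (z ^+ 2)
                  else if a == 0 then - complex.Im (z ^+ 2)
                  else complex.Im (z ^+ 2)).

Definition spin_rep (z : C) : 'M[C]_2 :=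
  (complex.Re z)%:C%C%:M + (complex.Im z)%:C%C *: (gamma 0 *m gamma 1).

(* Linear in the first argument, antilinear in the second. *)
Definition herm (u v : 'cV[C]_2) : C := \sum_(a < 2) u a 0 * Num.conj (v a 0).

End CliffordRep.

(* A spin structure as a lift to Spin(2) of the SO(2)-valued cocycle of a family
   of local oriented orthonormal frames whose domains cover the surface: the
   frames satisfy frame b = frame a . spin_cover (lift a b). *)
Record spin_structure (R : realType) (M : surface R)
    (h : riemannian_metric M) (o : orientation M) := SpinStructure {
  sidx : Type;
  sdom : sidx -> set M;
  sframe : sidx -> M -> 'I_2 -> tvec M;
  slift : sidx -> sidx -> M -> R[i];
  sdom_open : forall a, open (sdom a);
  sdom_cover : forall p, exists a, sdom a p;
  sframe_smooth : forall a k, smooth_vfield (sdom a) (fun p => sframe a p k);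
  sframe_orthonormal : forall a p, sdom a p ->
    oriented_orthonormal h o p (sframe a p);
  slift_smooth : forall a b, smooth_Cfun (sdom a `&` sdom b) (slift a b);
  slift_unit : forall a b p, sdom a p -> sdom b p -> `|slift a b p| = 1;
  slift_cover : forall a b p k, sdom a p -> sdom b p ->
    sframe b p k = \sum_(l < 2) spin_cover (slift a b p) l k *: sframe a p l;
  slift_cocycle : forall a b c p, sdom a p -> sdom b p -> sdom c p ->
    slift a b p * slift b c p = slift a c p }.

Section SpinorBundle.
Variables (R : realType) (M : surface R) (h : riemannian_metric M).
Variables (o : orientation M) (S : spin_structure h o).
Local Notation C := R[i].

(* The spinor bundle is associated to the spin structure by spin_rep.  An
   element of the fibre over p is given by its components in all the local
   trivializations around p, related by the transition functions; the other
   components are set to 0. *)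
Definition spinor : Type := sidx S -> 'cV[C]_2.

Definition spinor_fibre (p : M) : set spinor := [set phi : spinor |
  (forall a b, sdom a p -> sdom b p ->
     phi a = spin_rep (slift a b p) *m phi b) /\
  (forall a, ~ sdom a p -> phi a = 0)].

Definition smooth_spinor : set (M -> spinor) := [set psi : M -> spinor |
  (forall p, spinor_fibre p (psi p)) /\
  (forall (a : sidx S) (s : 'I_2), smooth_Cfun (sdom a) (fun p => psi p a s 0))].

Definition triv_at (p : M) : sidx S := projT1 (cid (sdom_cover S p)).

(* The value does not depend on the trivialization, because spin_rep is unitary
   on the unit circle. *)
Definition spinor_herm (p : M) (phi eta : spinor) : C :=
  herm (phi (triv_at p)) (eta (triv_at p)).

Definition spinor_norm2 (p : M) (phi : spinor) : C := spinor_herm p phi phi.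

(* X . phi, where h p X (sframe a p k) is the k-th component of X in the
   orthonormal frame sframe a p. *)
Definition clifford (p : M) (X : tvec M) (phi : spinor) : spinor :=
  fun a => if `[< sdom a p >]
    then (\sum_(k < 2) (h p X (sframe a p k))%:C%C *: gamma R k) *m phi a
    else 0.

(* omega_C = i e_0 . e_1, independent of the oriented orthonormal frame. *)
Definition volume_element (p : M) (phi : spinor) : spinor :=
  let e := sframe (triv_at p) p in
  ('i : C) *: clifford p (e 0) (clifford p (e 1) phi).

Definition Pplus (p : M) (phi : spinor) : spinor :=
  (2%:R^-1 : C) *: (phi + volume_element p phi).

Definition Pminus (p : M) (phi : spinor) : spinor :=
  (2%:R^-1 : C) *: (phi - volume_element p phi).

End SpinorBundle.

Definition isothermal (R : realType) (M : surface R) (h : riemannian_metric M)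
    (c : chart R M) : Prop :=
  atlas c /\
  exists lambda : M -> R, forall p, cdom c p -> 0 < lambda p /\
    forall k l : 'I_2,
      h p (coord_field c k p) (coord_field c l p) = lambda p * (k == l)%:R.

(* Main.v *)
(** Everything is pointwise. In the trivialization at [p], write
    [psi^j = (u_j, v_j)], so that [P_+ psi^j = (u_j, 0)] and
    [P_- psi^j = (0, v_j)]. A tangent vector with components [(X_0, X_1)] in the
    orthonormal frame acts by [(u, v) |-> (- xi^* v, xi u)], where
    [xi = X_0 + i X_1]. Let [xi] and [eta] represent [dx] and [dy]; these are
    orthogonal, that is [xi eta^* + xi^* eta = 0]. Then the left-hand side of the
    conclusion is
      [- 2 xi eta^* (u_i u_m^* sum_j |v_j|^2 - v_i v_m^* sum_j |u_j|^2)]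
    and its right-hand side is
      [- 2 xi eta^* (u_i u_m^* - v_i v_m^* ) sum_j (|u_j|^2 + |v_j|^2)];
    their difference is a multiple of the hypothesis. *)
Require Import Defs.
From mathcomp Require Import all_boot all_order all_algebra.
From mathcomp Require Import all_classical all_reals all_analysis.
From mathcomp Require Import complex ring.
Import Order.TTheory GRing.Theory Num.Theory.
Import numFieldNormedType.Exports.
Local Open Scope classical_set_scope.
Local Open Scope ring_scope.

Lemma near_eq_diff (R : numFieldType) (V W : normedModType R) (f g : V -> W)
    (x : V) : differentiable f x -> differentiable g x ->
  {near x, f =1 g} -> 'd f x = 'd g x :> (V -> W).
Proof.
move=> df dg fg; apply/funext => v.
rewrite -!deriveE //; exact: near_eq_derive.
Qed.

(** * Change of coordinates and orthonormal expansion of tangent vectors *)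

Section TangentSpace.
Set Implicit Arguments.
Unset Strict Implicit.
Variables (R : realType) (M : surface R).
Implicit Types (c d e : chart R M) (p : M) (X Y Z : tvec M).

Lemma differentiable_transition c d p : atlas c -> atlas d ->
  cdom c p -> cdom d p -> differentiable (transition c d) (cmap c p).
Proof.
move=> ac ad cp dp; have [/(_ 1%N)[+ _] _] := atlas_compatible ac ad.
by apply; exists p.
Qed.

(** Chain rule. The maps [transition d e \o transition c d] and [transition c e] need only agree
    near [cmap c p], and this suffices because a differential depends only on the germ. *)
Lemma dtransition_comp c d e p v : atlas c -> atlas d -> atlas e ->
  cdom c p -> cdom d p -> cdom e p ->
  dtransition d e p (dtransition c d p v) = dtransition c e p v.
Proof.
move=> ac ad ae cp dp ep; rewrite /dtransition.
have [_ _ cK _ cinv_cont] := atlas_chart ac.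
have [d_open _ dK _ _] := atlas_chart ad.
have dcd := differentiable_transition ac ad cp dp.
have dde := differentiable_transition ad ae dp ep.
have dce := differentiable_transition ac ae cp ep.
have : cmap d p = transition c d (cmap c p) by rewrite /transition /= cK.
move: (cmap d p) dde => y /[swap] -> dde.
apply: etrans (esym (congr1 (@^~ v) (diff_comp dcd dde))) _.
apply: (congr1 (@^~ v)).
apply: near_eq_diff; [exact: differentiable_comp|exact: dce|].
(* On this neighbourhood [cinv d] undoes [cmap d], so the two maps agree there. *)
have : \forall x \near cmap c p, cdom d (cinv c x).
  apply: (cinv_cont (cmap c p)); first by exists p.
  by rewrite cK //; exact: open_nbhs_nbhs.
by apply: filterS => x dx; rewrite /transition /= dK.
Qed.

Lemma tangent_coord_field c k p : atlas c -> cdom c p ->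
  tangent p (coord_field c k p).
Proof.
move=> ac cp; split=> [d e ad ae dp ep|d Nd]; rewrite /coord_field.
  by rewrite !asboolT // dtransition_comp.
by rewrite asboolF.
Qed.

Lemma tangent0 p : tangent p (0 : tvec M).
Proof. by split=> // c d *; rewrite /dtransition linear0. Qed.

Lemma tangentD p a X Y : tangent p X -> tangent p Y -> tangent p (a *: X + Y).
Proof.
move=> [X1 X2] [Y1 Y2]; split=> [c d ac ad cp dp|c Nc].
  rewrite /dtransition [in RHS]/= [LHS]/=.
  rewrite -[LHS]/(a *: X d + Y d) -[(a *: X + Y) c]/(a *: X c + Y c).
  by rewrite linearP (X1 c d) // (Y1 c d).
by rewrite -[LHS]/(a *: X c + Y c) X2 // Y2 // scaler0 addr0.
Qed.

Lemma tangent_eq c p X Y : atlas c -> cdom c p ->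
  tangent p X -> tangent p Y -> X c = Y c -> X = Y.
Proof.
move=> ac cp [X1 X2] [Y1 Y2] XY; apply/funext => d.
have [[ad dp]|Nd] := pselect (atlas d /\ cdom d p).
  by rewrite (X1 c d) // (Y1 c d) // XY.
by rewrite X2 // Y2.
Qed.

Variables (h : riemannian_metric M) (o : orientation M).

Lemma riem0 p X : tangent p X -> h p 0 X = 0.
Proof.
move=> tX; have := riem_linear h 1 (tangent0 p) (tangent0 p) tX.
rewrite scaler0 addr0 mul1r => /eqP.
by rewrite -subr_eq subrr eq_sym => /eqP.
Qed.

Lemma riemZ p a X Y : tangent p X -> tangent p Y ->
  h p (a *: X) Y = a * h p X Y.
Proof.
move=> tX tY; have := riem_linear h a tX (tangent0 p) tY.
by rewrite addr0 riem0 // addr0.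
Qed.

Lemma orthonormal_expansion p (e : 'I_2 -> tvec M) X :
  oriented_orthonormal h o p e -> tangent p X ->
  X = h p X (e 0) *: e 0 + h p X (e 1) *: e 1.
Proof.
move=> [te eE edet] tX.
have [c pc cp] := positive_cover o p.
have ac := positive_sub pc.
have tZ a k : tangent p (a *: e k).
  by rewrite -[_ *: _]addr0; exact: tangentD (te k) (tangent0 p).
(* The frame spans: in a positive chart around [p] its coordinate matrix has positive determinant,
   hence is invertible. Orthonormality then identifies the coefficients. *)
have [a [b ->]] : exists a b, X = a *: e 0 + b *: e 1.
  pose A := \matrix_(k < 2) e k c.
  have uA : A \in unitmx by rewrite unitmxE unitfE gt_eqF // edet.
  pose w := X c *m invmx A.
  exists (w 0 0), (w 0 1); apply: (tangent_eq ac cp) => //.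
    exact: tangentD.
  rewrite -[RHS]/(w 0 0 *: e 0 c + w 0 1 *: e 1 c).
  rewrite -[LHS](mulmxKV uA) -/w mulmx_sum_row big_ord_recl big_ord1 !rowK.
  by congr (_ *: e _ c + _ *: e _ c); try (congr (w _ _)); apply/val_inj.
by rewrite !riem_linear // !riemZ // !eE /= !mulr1 !mulr0 addr0 add0r.
Qed.

Lemma riem_orthonormal p (e : 'I_2 -> tvec M) X Y :
  oriented_orthonormal h o p e -> tangent p X -> tangent p Y ->
  h p X Y = h p X (e 0) * h p Y (e 0) + h p X (e 1) * h p Y (e 1).
Proof.
move=> oe tX tY; have [te _ _] := oe.
rewrite {1}(orthonormal_expansion oe tX).
have tZ : tangent p (h p X (e 1) *: e 1).
  by rewrite -[_ *: _]addr0; exact: tangentD (te 1) (tangent0 p).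
by rewrite riem_linear // riemZ // (riem_sym h (te 0)) // (riem_sym h (te 1)).
Qed.

End TangentSpace.

(** * Clifford multiplication in the trivialization chosen at [p] *)

Section Fibre.
Set Implicit Arguments.
Unset Strict Implicit.
Variables (R : realType) (M : surface R) (h : riemannian_metric M).
Variables (o : orientation M) (S : spin_structure h o) (p : M).
Implicit Types (X : tvec M) (phi eta : spinor S).
Local Notation C := R[i].
Local Notation t := (triv_at S p).

Lemma spinorZE a phi b k : (a *: phi) b k 0 = a * phi b k 0.
Proof. by rewrite -[LHS]/((a *: phi b) k 0) mxE. Qed.

Lemma spinorDE phi eta b k : (phi + eta) b k 0 = phi b k 0 + eta b k 0.
Proof. by rewrite -[LHS]/((phi b + eta b) k 0) mxE. Qed.

Lemma spinorNE phi b k : (- phi) b k 0 = - phi b k 0.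
Proof. by rewrite -[LHS]/((- phi b) k 0) mxE. Qed.

Lemma sdom_triv_at : sdom t p.
Proof. exact: projT2 (cid (sdom_cover S p)). Qed.

(** This is the number [xi] of the overview; it identifies the tangent plane with the complex line
    through the frame of [triv_at]. *)
Definition frame_coord X : C :=
  (h p X (sframe t p 0))%:C%C + 'i * (h p X (sframe t p 1))%:C%C.

Lemma conj_frame_coord X : (frame_coord X)^* =
  (h p X (sframe t p 0))%:C%C - 'i * (h p X (sframe t p 1))%:C%C.
Proof.
have cR (a : R) : (a%:C%C : C)^* = a%:C%C by exact: conjc_real.
by rewrite /frame_coord rmorphD rmorphM /= conjCi !cR mulNr.
Qed.

Lemma spinor_hermE phi eta : spinor_herm p phi eta =
  phi t 0 0 * (eta t 0 0)^* + phi t 1 0 * (eta t 1 0)^*.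
Proof.
rewrite /spinor_herm /herm big_ord_recl big_ord1.
by congr (_ + phi t _ 0 * (eta t _ 0)^*); apply/val_inj.
Qed.

Lemma cliffordE X phi :
  (clifford p X phi t 0 0 = - ((frame_coord X)^* * phi t 1 0)) *
  (clifford p X phi t 1 0 = frame_coord X * phi t 0 0).
Proof.
rewrite conj_frame_coord /frame_coord /clifford asboolT; last exact: sdom_triv_at.
have l1 : lift ord0 ord0 = 1 :> 'I_2 by apply/val_inj.
split; rewrite mxE !big_ord_recl !big_ord0 !l1 !mxE /=; ring.
Qed.

(** Antilinearity in the second argument exchanges [xi] and its conjugate. *)
Lemma spinor_herm_clifford phi X eta : spinor_herm p phi (clifford p X eta) =
  (frame_coord X)^* * phi t 1 0 * (eta t 0 0)^* -
  frame_coord X * phi t 0 0 * (eta t 1 0)^*.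
Proof.
rewrite spinor_hermE; have [-> ->] := cliffordE X eta.
rewrite rmorphN /= 2!rmorphM /= conjCK; ring.
Qed.

Lemma spinor_herm_clifford2 phi X Y eta :
  spinor_herm p phi (clifford p X (clifford p Y eta)) =
  - (frame_coord X * (frame_coord Y)^* * (phi t 0 0 * (eta t 0 0)^*) +
     (frame_coord X)^* * frame_coord Y * (phi t 1 0 * (eta t 1 0)^*)).
Proof.
rewrite spinor_herm_clifford; have [-> ->] := cliffordE Y eta.
rewrite rmorphN /= 2!rmorphM /= conjCK; ring.
Qed.

(** The frame vectors have [frame_coord] equal to 1 and ['i], so the volume element acts as diag(1,
    -1). *)
Lemma volume_elementE phi :
  (volume_element p phi t 0 0 = phi t 0 0) *
  (volume_element p phi t 1 0 = - phi t 1 0).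
Proof.
have [_ eE _] := sframe_orthonormal sdom_triv_at.
rewrite /volume_element !spinorZE !cliffordE !conj_frame_coord /frame_coord !eE /=.
rewrite !(rmorph0, rmorph1).
have i2 : ('i : C) * 'i = -1 by rewrite -expr2 sqrCi.
split.
  transitivity (- ('i * 'i : C) * phi t 0 0); first by ring.
  by rewrite i2 opprK mul1r.
transitivity (('i * 'i : C) * phi t 1 0); first by ring.
by rewrite i2 mulN1r.
Qed.

Lemma PplusE phi : (Pplus p phi t 0 0 = phi t 0 0) * (Pplus p phi t 1 0 = 0).
Proof.
rewrite /Pplus !spinorZE !spinorDE !volume_elementE; split; last by rewrite subrr mulr0.
by field.
Qed.

Lemma PminusE phi : (Pminus p phi t 0 0 = 0) * (Pminus p phi t 1 0 = phi t 1 0).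
Proof.
rewrite /Pminus !spinorZE !spinorDE !spinorNE !volume_elementE; split; first by rewrite subrr mulr0.
by field.
Qed.

Lemma spinor_herm_Pplus phi eta :
  spinor_herm p (Pplus p phi) (Pplus p eta) = phi t 0 0 * (eta t 0 0)^*.
Proof.
move: (PplusE phi) (PplusE eta); move: (Pplus p phi) (Pplus p eta) => f g [f0 f1] [g0 g1].
by rewrite spinor_hermE f0 f1 g0 g1 mul0r addr0.
Qed.

Lemma spinor_herm_Pminus phi eta :
  spinor_herm p (Pminus p phi) (Pminus p eta) = phi t 1 0 * (eta t 1 0)^*.
Proof.
move: (PminusE phi) (PminusE eta); move: (Pminus p phi) (Pminus p eta) => f g [f0 f1] [g0 g1].
by rewrite spinor_hermE f0 f1 g0 g1 mul0r add0r.
Qed.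

(** The real part of the product on the left is [h p X Y], by [riem_orthonormal]; so the product is
    purely imaginary. *)
Lemma frame_coord_orthogonal X Y : tangent p X -> tangent p Y -> h p X Y = 0 ->
  frame_coord X * (frame_coord Y)^* =
  - ((frame_coord X)^* * frame_coord Y).
Proof.
move=> tX tY; rewrite (riem_orthonormal (sframe_orthonormal sdom_triv_at)) //.
rewrite !conj_frame_coord /frame_coord => /(congr1 (fun a : R => a%:C%C : C)).
rewrite rmorphD !rmorphM rmorph0 /=.
set a := (_%:C)%C; set b := (_%:C)%C; set a' := (_%:C)%C; set b' := (_%:C)%C.
move=> ab0; have i2 : ('i : C) * 'i = -1 by rewrite -expr2 sqrCi.
apply/eqP; rewrite -subr_eq0 opprK; apply/eqP.
(* The factor ['i * 'i] is kept apart so that [i2] can rewrite it. *)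
transitivity (2%:R * (a * b - ('i * 'i) * (a' * b')) : C); first by ring.
by rewrite i2 mulN1r opprK ab0 mulr0.
Qed.

End Fibre.

Theorem corollary3p19 (R : realType) (M : surface R)
  (h : riemannian_metric M) (o : orientation M) (S : spin_structure h o)
  (c : chart R M) (hc : isothermal h c)
  (q : nat) (psi : 'I_q -> M -> spinor S)
  (hpsi : forall j, smooth_spinor (psi j)) (i m : 'I_q) :
  let dx := coord_field c 0 in
  let dy := coord_field c 1 in
  (forall p, cdom c p ->
    \sum_(j < q) spinor_norm2 p (Pminus p (psi j p)) *
      spinor_herm p (Pminus p (psi i p)) (Pminus p (psi m p)) =
    \sum_(j < q) spinor_norm2 p (Pplus p (psi j p)) *
      spinor_herm p (Pplus p (psi i p)) (Pplus p (psi m p))) ->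
  forall p, cdom c p ->
    \sum_(j < q)
      (spinor_herm p (psi i p) (clifford p (dx p) (psi j p)) *
       spinor_herm p (psi j p) (clifford p (dy p) (psi m p)) -
       spinor_herm p (psi i p) (clifford p (dy p) (psi j p)) *
       spinor_herm p (psi j p) (clifford p (dx p) (psi m p))) =
    2%:R * spinor_herm p (psi i p) (clifford p (dx p) (clifford p (dy p) (psi m p)))
      * \sum_(j < q) spinor_norm2 p (psi j p).
Proof.
move=> dx dy hyp p cp; have [ac [lambda lambdaE]] := hc.
(* The off-diagonal isothermal condition says that [dx] and [dy] are orthogonal. *)
have [_ /(_ 0 1)] := lambdaE p cp; rewrite /= mulr0 => /(frame_coord_orthogonal S).
move=> /(_ (tangent_coord_field _ ac cp) (tangent_coord_field _ ac cp)).
rewrite -/dx -/dy.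
set xi := frame_coord _ _ (dx p); set eta := frame_coord _ _ (dy p) => xi_eta.
pose t := triv_at S p.
pose u j : R[i] := psi j p t 0 0; pose v j : R[i] := psi j p t 1 0.
pose U := \sum_(j < q) u j * (u j)^*.
pose V := \sum_(j < q) v j * (v j)^*.
(* The hypothesis in components: each projection keeps one component, and the factor independent of
   [j] leaves the sum. *)
have UV : V * (v i * (v m)^*) = U * (u i * (u m)^*).
  rewrite !mulr_suml; apply: etrans (etrans _ (hyp p cp)) _;
    apply: eq_bigr => j _; rewrite /spinor_norm2.
    by congr (_ * _); rewrite spinor_herm_Pminus.
  by congr (_ * _); rewrite spinor_herm_Pplus.
have -> : \sum_(j < q) spinor_norm2 p (psi j p) = U + V.
  by rewrite -big_split /=; apply: eq_bigr => j _; rewrite /spinor_norm2 spinor_hermE.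
(* The terms in [xi * eta] and in [xi^* * eta^*] are symmetric in the two vectors and cancel in the
   antisymmetrization. *)
transitivity ((xi^* * eta - xi * eta^*) *
    (u i * (u m)^* * V - v i * (v m)^* * U)).
  rewrite !mulr_sumr -sumrB mulr_sumr; apply: eq_bigr => j _.
  rewrite 4!spinor_herm_clifford -/xi -/eta -/t /u /v; ring.
rewrite spinor_herm_clifford2 -/xi -/eta -/t -/(u i) -/(u m) -/(v i) -/(v m).
move: xi_eta UV; set X := xi^*; set Y := eta^*.
set um := (u m)^*; set vm := (v m)^* => xi_eta UV.
apply/eqP; rewrite -subr_eq0; apply/eqP.
(* Replacing [xi * Y] by [- (X * eta)] in the difference of the two sides leaves the first summand,
   a multiple of [UV]; the second collects the multiples of [xi * Y + X * eta], which vanishes by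
   [xi_eta]. *)
transitivity (2%:R * (X * eta) * (V * (v i * vm) - U * (u i * um)) +
  (xi * Y + X * eta) * (u i * um * (V + U *+ 2) + v i * vm * U)).
  ring.
by rewrite UV subrr mulr0 add0r xi_eta addNr mul0r.
Qed.
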